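(* Let $\mathcal{G}$ be a class of graphs that is closed under clique replacement, let $t \ge 1$ be an integer and $\gamma \ge 1$ a real number, and suppose $\mathcal{G}$ is $(t,\gamma)$-conditionally $\chi$-bounded. Then for every graph $G \in \mathcal{G}$ and every choice of nonnegative vertex weights $(w_i)_{i \in V(G)}$, the optimum value of the $t$-th level sum-of-squares relaxation, $\max\{\sum_{i \in V(G)} w_i z_i : z \in \mathrm{SoS}_t(K_G)\}$, is at most $\gamma$ times the maximum weight of an independent set of $G$ (i.e., $t$ rounds of SoS give a factor-$\gamma$ estimation for the maximum-weight independent set problem on $\mathcal{G}$).
   Context: A clique replacement on a graph $H$ replaces a vertex $v \in V(H)$ by a clique $K_v$ of arbitrary size and connects every vertex of $K_v$ to all neighbors of $v$. A graph $G$ is $(t,\gamma)$-conditionally $\chi$-bounded if $\chi(G) \le \gamma\,\omega(G)$ whenever $\alpha(G) \ge t$; a graph class is $(t,\gamma)$-conditionally $\chi$-bounded if every graph in it is. Here $\alpha,\omega,\chi$ are the independence number, clique number and chromatic number. For a graph $G$, $K_G=\{x\in[0,1]^{V(G)} : x_i+x_j\le 1\ \forall (i,j)\in E(G)\}$. The $t$-th level of the sum-of-squares (Lasserre) hierarchy $\mathrm{SoS}_t(K_G)$ is the set of vectors $z=(z_I)_{I\subseteq V(G)}\in\mathbb{R}^{2^{V(G)}}$ with $z_\emptyset=1$ such that the matrix $M_t(z)=(z_{I\cup J})_{|I|,|J|\le t}$ is positive semidefinite and, for every edge $(i,j)\in E(G)$, the matrix $M^{ij}_t(z)=(z_{I\cup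 J}-z_{I\cup J\cup\{i\}}-z_{I\cup J\cup\{j\}})_{|I|,|J|\le t}$ is positive semidefinite; $z_i$ denotes $z_{\{i\}}$. *)

(* Defs.v *)
From HB Require Import structures.
From mathcomp Require Import all_boot all_order all_algebra.
From mathcomp Require Import classical_sets constructive_ereal reals ereal.

Set Implicit Arguments.
Unset Strict Implicit.
Unset Printing Implicit Defensive.

Import Order.TTheory GRing.Theory Num.Theory.
Local Open Scope ring_scope.

Record sgraph := SGraph {
  vertex :> finType;
  adj : rel vertex;
  adj_sym : symmetric adj;
  adj_irr : irreflexive adj }.

Section GraphParameters.
Variable G : sgraph.
Implicit Types A : {set G}.

Definition stable A := [forall x in A, forall y in A, ~~ adj x y].
Definition clique A := [forall x in A, forall y in A, (x != y) ==> adj x y].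

Definition alpha : nat := (\max_(A : {set G} | stable A) #|A|)%N.
Definition omega : nat := (\max_(A : {set G} | clique A) #|A|)%N.

Definition colorable (k : nat) :=
  [exists f : {ffun G -> 'I_k}, forall x, forall y, adj x y ==> (f x != f y)].

Lemma colorable_ex : exists k, colorable k.
Proof.
exists #|G|; apply/existsP; exists [ffun x => enum_rank x].
apply/forallP => x; apply/forallP => y; apply/implyP => xy.
rewrite !ffunE; apply: contraTneq xy => /enum_rank_inj ->.
by rewrite adj_irr.
Qed.

Definition chi : nat := ex_minn colorable_ex.

End GraphParameters.

Section CliqueReplacement.
Variables (H : sgraph) (v : H) (k : nat).

(* [inl x] is a vertex x of H other than v; the vertices [inr i] form K_v. *)
Definition repl_vertex : finType := ({x : H | x != v} + 'I_k)%type.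

Definition repl_adj (a b : repl_vertex) : bool :=
  match a, b with
  | inl x, inl y => adj (val x) (val y)
  | inl x, inr _ => adj (val x) v
  | inr _, inl y => adj v (val y)
  | inr i, inr j => i != j
  end.

Lemma repl_adj_sym : symmetric repl_adj.
Proof. by move=> [x|i] [y|j] //=; rewrite ?(eq_sym i) // adj_sym. Qed.

Lemma repl_adj_irr : irreflexive repl_adj.
Proof. by move=> [x|i] /=; rewrite ?adj_irr ?eqxx. Qed.

Definition clique_replacement := SGraph repl_adj_sym repl_adj_irr.

End CliqueReplacement.

(* K_v is required to be nonempty: k = 0 would be the deletion of v. *)
Definition closed_under_clique_replacement (C : sgraph -> Prop) : Prop :=
  forall H : sgraph, C H ->
  forall (v : H) (k : nat), (0 < k)%N -> C (clique_replacement v k).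

Section Reals.
Variable R : realType.

Definition cond_chi_bounded (t : nat) (gamma : R) (G : sgraph) : Prop :=
  (t <= alpha G)%N -> (chi G)%:R <= gamma * (omega G)%:R.

Definition class_cond_chi_bounded (t : nat) (gamma : R) (C : sgraph -> Prop) :=
  forall G : sgraph, C G -> cond_chi_bounded t gamma G.

(* For nonnegative weights the default value 0 is the weight of the empty set. *)
Definition max_stable_weight (G : sgraph) (w : G -> R) : R :=
  \big[Order.max/0]_(A : {set G} | stable A) \sum_(i in A) w i.

Definition psd (n : nat) (M : 'M[R]_n) : Prop :=
  M^T = M /\ forall x : 'rV[R]_n, 0 <= (x *m M *m x^T) 0 0.

Section SumOfSquares.
Variables (G : sgraph) (t : nat).

(* Rows and columns of the moment matrices are numbered through [enum_val] by
   the vertex sets of cardinality at most t. *)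
Definition small_sets : {set {set G}} := [set I : {set G} | (#|I| <= t)%N].

Definition moment_mx (z : {set G} -> R) : 'M[R]_#|small_sets| :=
  \matrix_(a, b) z (enum_val a :|: enum_val b).

Definition edge_moment_mx (i j : G) (z : {set G} -> R) : 'M[R]_#|small_sets| :=
  \matrix_(a, b) let K := enum_val a :|: enum_val b in
    z K - z (K :|: [set i]) - z (K :|: [set j]).

Definition SoS (z : {set G} -> R) : Prop :=
  [/\ z finset.set0 = 1,
      psd (moment_mx z)
    & forall i j : G, adj i j -> psd (edge_moment_mx i j z)].

(* The supremum in the extended reals, so that an upper bound on it is
   meaningful without first knowing that the maximum is attained. *)
Definition SoS_value (w : G -> R) : \bar R :=
  ereal_sup [set (\sum_(i : G) w i * z [set i]%SET)%:E | z in SoS]%classic.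

End SumOfSquares.

End Reals.

(* Main.v *)
Require Import Defs.
From mathcomp Require Import all_boot all_order all_algebra.
From mathcomp Require Import constructive_ereal reals ereal.
From mathcomp Require Import ring lra.

(** If [alpha G < t], Moebius inversion writes a point of the relaxation as a
combination of indicator vectors of stable sets whose coefficients are values
of the quadratic form of the moment matrix; so the relaxation is exact.
Otherwise, already the first level implies the clique inequalities
[\sum_(i in K) z i <= 1].  Replacing each vertex [v] by a clique of size
about [N * z v] gives a graph of the class with clique number at most about
[N], hence with a proper colouring in about [gamma * N] colours.  Each colour
class projects injectively onto a stable set of [G], so that
[N * \sum_v w v * z v] is at most about [gamma * N] times the maximum weight of
a stable set; then let [N] tend to infinity. *)

Set Implicit Arguments.
Unset Strict Implicit.
Unset Printing Implicit Defensive.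

Import Order.TTheory GRing.Theory Num.Theory.
Local Open Scope ring_scope.

(** * Quadratic forms indexed by families of sets *)

(** Frees later arguments from the numbering of rows: the coefficients of all [k] with the same
    [A k] are collected into one row vector [x], and the double sum is the form of the matrix at
    [x]. *)
Lemma psd_family (R : realType) (T : finType) (D : {set T}) (F : T -> T -> R)
    (K : finType) (P : pred K) (A : K -> T) (c : K -> R) :
  psd (\matrix_(a < #|D|, b < #|D|) F (enum_val a) (enum_val b)) ->
  (forall k, P k -> A k \in D) ->
  0 <= \sum_(k | P k) \sum_(l | P l) c k * c l * F (A k) (A l).
Proof.
move=> [_ psdF] AD.
pose x : 'rV[R]_#|D| := \row_a \sum_(k | P k) c k * (A k == enum_val a)%:R.
have xE (f : T -> R) :
    \sum_a x 0 a * f (enum_val a) = \sum_(k | P k) c k * f (A k).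
  under eq_bigr do rewrite mxE mulr_suml.
  rewrite exchange_big; apply: eq_bigr => k Pk.
  under eq_bigr do rewrite -mulrA.
  rewrite -mulr_sumr -(big_enum_val (fun u => (A k == u)%:R * f u)) /=.
  rewrite (bigD1 (A k)) ?AD //= eqxx mul1r big1 ?addr0 // => u /andP[_].
  by rewrite eq_sym => /negPf ->; rewrite mul0r.
suff -> : \sum_(k | P k) \sum_(l | P l) c k * c l * F (A k) (A l)
    = (x *m (\matrix_(a, b) F (enum_val a) (enum_val b)) *m x^T) 0 0 by [].
transitivity (\sum_b x 0 b * \sum_a x 0 a * F (enum_val a) (enum_val b)).
  rewrite (xE (fun v => \sum_a x 0 a * F (enum_val a) v)) exchange_big /=.
  apply: eq_bigr => l _; rewrite (xE (F^~ (A l))) mulr_sumr.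
  by apply: eq_bigr => k _; rewrite mulrCA mulrA.
rewrite mxE; apply: eq_bigr => b _; rewrite mulrC !mxE; congr (_ * _).
by apply: eq_bigr => a _; rewrite !mxE.
Qed.

(** * Moebius inversion on the subset lattice *)

Lemma sum_sign_interval (R : pzRingType) (T : finType) (A B : {set T}) :
  \sum_(S : {set T} | (A \subset S) && (S \subset B)) (-1) ^+ #|S|
    = (A == B)%:R * (-1) ^+ #|A| :> R.
Proof.
have [->|neqAB] := eqVneq A B.
  rewrite mul1r (big_pred1 B) // => S /=.
  by rewrite eqEsubset andbC.
rewrite mul0r.
have [sAB|nsAB] := boolP (A \subset B); last first.
  by rewrite big_pred0 // => S; apply: contraNF nsAB => /andP[];
    apply: subset_trans.
(* Adding or removing a fixed b of B outside A is a sign-reversing involution. *)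
have /properP[_ [b bB bA]] : A \proper B by rewrite properEneq neqAB.
rewrite (bigID (fun S : {set T} => b \in S)) /=.
rewrite [X in X + _](reindex_onto (fun S => b |: S) (fun S => S :\ b)) /=; last first.
  by move=> S /andP[_ bS]; rewrite setD1K.
rewrite -[RHS](addNr (\sum_(S : {set T} |
  (A \subset S) && (S \subset B) && (b \notin S)) (-1) ^+ #|S|)).
congr (_ + _); rewrite -sumrN; apply: eq_big => S.
  have [bS|bS] := boolP (b \in S).
    rewrite andbF; apply/negbTE; rewrite negb_and; apply/orP; right.
    by apply/eqP => /setP/(_ b); rewrite !inE bS eqxx.
  rewrite setU1K // eqxx !andbT setU11 andbT subUset sub1set bB /=; congr (_ && _).
  apply/idP/idP => [/subsetP sA|sA]; last by apply: subset_trans sA (subsetUr _ _).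
  apply/subsetP => a aA; have := sA a aA; rewrite !inE => /orP[/eqP ab|//].
  by rewrite -ab aA in bA.
move=> /andP[_ /eqP bS]; rewrite cardsU1 -bS !inE eqxx /= exprS mulN1r.
by rewrite -bS.
Qed.

(** If [y U] is the probability that a random set contains [U], this is the probability that it
    equals [S]. The usual sign, given by the size of [U] minus [S], is split into two factors. *)
Definition moebius (R : pzRingType) (T : finType) (y : {set T} -> R)
    (S : {set T}) : R :=
  (-1) ^+ #|S| * \sum_(U : {set T} | S \subset U) (-1) ^+ #|U| * y U.

Lemma moebiusK (R : comPzRingType) (T : finType) (y : {set T} -> R)
    (U : {set T}) :
  \sum_(S : {set T} | U \subset S) moebius y S = y U.
Proof.
rewrite /moebius; under eq_bigr do rewrite mulr_sumr.
rewrite (exchange_big_dep (fun V : {set T} => U \subset V)) /=; last first.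
  by move=> S V; apply: subset_trans.
transitivity (\sum_(V : {set T} | U \subset V)
    (-1) ^+ #|V| * y V * ((U == V)%:R * (-1) ^+ #|U|)).
  apply: eq_bigr => V sUV; rewrite -sum_sign_interval mulr_sumr.
  by apply: eq_bigr => S _; rewrite mulrC.
rewrite (bigD1 U) //= eqxx mul1r big1 ?addr0 => [|V /andP[_ /negPf]].
  by rewrite mulrAC -signr_odd -expr2 sqrr_sign mul1r.
by rewrite eq_sym => ->; rewrite mul0r mulr0.
Qed.

(** Expand [y (U :|: V)] over the supersets [S] of [U :|: V]. For fixed [S] the sums over [U] and
    [V] separate into the square of one signed interval sum, which vanishes unless [S] is [A]. *)
Lemma moebius_form (R : comPzRingType) (T : finType) (y : {set T} -> R)
    (A : {set T}) :
  \sum_(U : {set T} | A \subset U) \sum_(V : {set T} | A \subset V)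
     (-1) ^+ #|U| * (-1) ^+ #|V| * y (U :|: V) = moebius y A.
Proof.
transitivity (\sum_(S : {set T}) moebius y S * ((A == S)%:R * (-1) ^+ #|A|) ^+ 2).
  under eq_bigr => U _.
    under eq_bigr => V _ do rewrite -moebiusK mulr_sumr big_mkcond /=.
    rewrite exchange_big /=; over.
  rewrite exchange_big /=; apply: eq_bigr => S _.
  rewrite -sum_sign_interval expr2 mulr_sumr big_mkcondr /=.
  rewrite mulr_sumr; apply: eq_bigr => U AU.
  case: ifP => US; last by rewrite mulr0 big1 // => V _; rewrite subUset US.
  rewrite mulr_suml mulr_sumr big_mkcondr /=; apply: eq_bigr => V AV.
  by rewrite subUset US /=; case: ifP => // VS; ring.
rewrite (bigD1 A) //= eqxx mul1r sqrr_sign mulr1 big1 ?addr0 // => S.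
by rewrite eq_sym => /negPf ->; rewrite mul0r expr2 mul0r mulr0.
Qed.

(** * Stable sets and inequalities valid for the relaxation *)

Lemma alpha_ge (G : sgraph) (A : {set G}) : stable A -> (#|A| <= alpha G)%N.
Proof. by move=> sA; apply: leq_bigmax_cond. Qed.

Lemma stableS (G : sgraph) (A B : {set G}) : A \subset B -> stable B -> stable A.
Proof.
move=> /subsetP sAB /forall_inP sB; apply/forall_inP => x xA.
apply/forall_inP => y yA.
by have /forall_inP := sB _ (sAB _ xA); apply; apply: sAB.
Qed.

Section SoSFacts.
Variables (R : realType) (G : sgraph) (t : nat) (z : {set G} -> R).
Hypotheses (t_ge1 : (1 <= t)%N) (zSoS : SoS t z).

Lemma SoS_form (K : finType) (P : pred K) (A : K -> {set G}) (c : K -> R) :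
  (forall k, P k -> (#|A k| <= t)%N) ->
  0 <= \sum_(k | P k) \sum_(l | P l) c k * c l * z (A k :|: A l).
Proof.
case: zSoS => _ psdM _ At.
apply: (@psd_family R _ (small_sets G t) (fun U V => z (U :|: V))) => // k Pk.
by rewrite inE At.
Qed.

Lemma SoS_ge0 (A : {set G}) : (#|A| <= t)%N -> 0 <= z A.
Proof.
move=> At; have := @SoS_form 'I_1 xpredT (fun=> A) (fun=> 1) (fun _ _ => At).
by rewrite !big_ord1 setUid !mul1r.
Qed.

(** The diagonal entry of the edge matrix at [[set i]] is [z [set i] - z [set i] - z [set i; j]]. *)
Lemma SoS_edge_le0 (i j : G) : adj i j -> z [set i; j] <= 0.
Proof.
case: zSoS => _ _ /(_ i j) psdE /psdE.
pose F (U V : {set G}) :=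
  z (U :|: V) - z (U :|: V :|: [set i]) - z (U :|: V :|: [set j]).
move=> {}psdE; have := @psd_family R _ (small_sets G t) F 'I_1 xpredT
  (fun=> [set i]) (fun=> 1) psdE.
rewrite !big_ord1 !mul1r /F !setUid subrr sub0r oppr_ge0; apply=> _ _.
by rewrite inE cards1.
Qed.

(** Evaluate the moment form with coefficient -1 at the empty set and 1 at the singletons of [K]: it
    equals [1 - 2 s] plus all pair terms, whose diagonal contributes [s] and whose other entries are
    nonpositive. *)
Lemma SoS_clique_sum_le1 (K : {set G}) : clique K -> \sum_(i in K) z [set i] <= 1.
Proof.
move=> cK; set s := \sum_(i in K) _.
pose A (o : option G) : {set G} := if o is Some i then [set i] else set0.
pose c (o : option G) : R := if o is Some _ then 1 else -1.
have := @SoS_form _ (fun o => if o is Some i then i \in K else true) A c.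
have z0 : z set0 = 1 by case: zSoS.
have optE (P : pred (option G)) (f : option G -> R) : P None ->
    \sum_(o | P o) f o = f None + \sum_(i | P (Some i)) f (Some i).
  move=> PN; rewrite (bigD1 None) //=; congr (_ + _).
  rewrite (reindex_omap Some id) => [|[i|] /andP[]] //=.
  by apply: eq_bigl => i; rewrite eqxx !andbT.
rewrite !optE //= /A /= setUid z0.
have -> : \sum_(i in K) (-1) * 1 * z (set0 :|: [set i]) = - s.
  by rewrite -sumrN; apply: eq_bigr => i _; rewrite set0U mulr1 mulN1r.
(* In row [i] the entry at the empty set cancels the diagonal one, leaving only edge terms. *)
have le : \sum_(i in K) \sum_(o | if o is Some j then j \in K else true)
    1 * c o * z ([set i] :|: A o) <= \sum_(i in K) 0.
  apply: ler_sum => i iK.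
  rewrite optE //= setU0 mul1r mulN1r (bigD1 i) //= setUid !mul1r addrA addNr add0r.
  apply: sumr_le0 => j /andP[jK ji]; rewrite !mul1r.
  by apply: SoS_edge_le0; have /forall_inP/(_ i iK)/forall_inP/(_ j jK) := cK;
    rewrite eq_sym ji.
rewrite sumr_const mul0rn in le.
move=> /(_ _); rewrite mulrNN mul1r => H.
have : 0 <= 1 * 1 + - s +
    \sum_(i in K) \sum_(o | if o is Some j then j \in K else true)
    1 * c o * z ([set i] :|: A o).
  by apply: H => -[i|] _; rewrite ?cards1 ?cards0.
lra.
Qed.

(** A zero diagonal entry of a positive semidefinite matrix forces its row to vanish; otherwise the
    form on [A], [B] is affine and nonconstant in the coefficient of [A]. *)
Lemma SoS_zero_row (A B : {set G}) :
  (#|A| <= t)%N -> (#|B| <= t)%N -> z A = 0 -> z (A :|: B) = 0.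
Proof.
move=> At Bt zA; have [//|nz] := eqVneq (z (A :|: B)) 0.
have form s := @SoS_form bool xpredT (fun b => if b then A else B)
  (fun b => if b then s else 1).
(* Solves [2 * s * z (A :|: B) + z B = -1]. *)
set s := - (z B + 1) / (2 * z (A :|: B)).
have : 0 <= s * s * 0 + s * 1 * z (A :|: B) + (1 * s * z (A :|: B) + 1 * 1 * z B).
  by have := form s; rewrite !big_bool /= !setUid zA (setUC B A); apply=> -[].
have -> : s * s * 0 + s * 1 * z (A :|: B) + (1 * s * z (A :|: B) + 1 * 1 * z B) = -1.
  by rewrite /s; field.
by rewrite ler0N1.
Qed.

(** * Exactness when the independence number is below [t] *)

Section Exact.
Hypothesis alpha_lt : (alpha G < t)%N.

Lemma SoS_edge0 (i j : G) : adj i j -> z [set i; j] = 0.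
Proof.
move=> ij; apply/eqP; rewrite eq_le SoS_edge_le0 //= SoS_ge0 //.
(* The stable set [[set i]] gives [alpha G >= 1], so [t >= 2] and [[set i; j]] indexes a diagonal
   entry. *)
apply: (leq_trans _ alpha_lt); rewrite cards2.
have /alpha_ge : stable [set i].
  apply/forall_inP => x /set1P ->; apply/forall_inP => y /set1P ->.
  by rewrite adj_irr.
by rewrite cards1; case: (i != j) => //= /leqW.
Qed.

Lemma SoS_nonstable0 (U V : {set G}) :
  stable U -> stable V -> ~~ stable (U :|: V) -> z (U :|: V) = 0.
Proof.
move=> sU sV /forall_inPn[i iUV /forall_inPn[j jUV]]; rewrite negbK => ij.
have lt_t (W : {set G}) : stable W -> (#|W| < t)%N.
  by move=> /alpha_ge/leq_ltn_trans; apply.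
(* An edge inside U :|: V joins U to V, so that U plus one vertex is already
   dependent, while still of size at most t. *)
have aux k l : adj k l -> k \in U -> l \in V -> z (U :|: V) = 0.
  move=> kl kU lV.
  (* Vanishing spreads from the edge to its union with [U], and from there to the union with [V]. *)
  have -> : U :|: V = ([set k; l] :|: U) :|: V.
    apply/setP => x; rewrite !inE.
    by case: eqP => [->|_]; [rewrite kU|case: eqP => [->|_]; rewrite ?lV ?orbT].
  apply: SoS_zero_row; [|exact: ltnW (lt_t _ sV)|].
    have -> : [set k; l] :|: U = l |: U.
      by apply/setP => x; rewrite !inE; case: eqP => //= ->; rewrite kU orbT.
    by rewrite cardsU1; apply: leq_trans (lt_t _ sU); rewrite -add1n leq_add2r leq_b1.
  apply: SoS_zero_row; [|exact: ltnW (lt_t _ sU)|exact: SoS_edge0].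
  apply: leq_trans (lt_t _ sU).
  by rewrite cards2; case: (k != l) => //=; rewrite ltnS card_gt0; apply/set0Pn; exists k.
case/setUP: iUV => [iU|iV]; case/setUP: jUV => [jU|jV].
- by have /forall_inP/(_ i iU)/forall_inP/(_ j jU) := sU; rewrite ij.
- exact: aux ij iU jV.
- by apply: aux jU iV; rewrite adj_sym.
- by have /forall_inP/(_ i iV)/forall_inP/(_ j jV) := sV; rewrite ij.
Qed.

Lemma SoS_exact (w : G -> R) : (forall i, 0 <= w i) ->
  \sum_i w i * z [set i] <= max_stable_weight w.
Proof.
(* Cutting [z] off outside stable sets discards the values at large sets, which the moment matrix
   need not control. *)
move=> w_ge0; pose y (U : {set G}) := if stable U then z U else 0.
pose mu := moebius y.
have mu_ge0 S : 0 <= mu S.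
  rewrite /mu -moebius_form.
  (* Only stable [U] and [V] enter, so their sizes stay below [t]; all other terms of [moebius_form]
     vanish for [y]. *)
  have := @SoS_form _ (fun U : {set G} => (S \subset U) && stable U) id
    (fun U => (-1) ^+ #|U|).
  rewrite big_mkcondr /=.
  under eq_bigr => U SU.
    have -> : (if stable U then \sum_(V : {set G} | (S \subset V) && stable V)
          (-1) ^+ #|U| * (-1) ^+ #|V| * z (U :|: V) else 0)
        = \sum_(V : {set G} | S \subset V) (-1) ^+ #|U| * (-1) ^+ #|V| * y (U :|: V).
      have [sU|nsU] := boolP (stable U); last first.
        rewrite big1 // => V _; rewrite /y ifN ?mulr0 //.
        by apply: contra nsU; apply: stableS; apply: subsetUl.
      rewrite big_mkcondr; apply: eq_bigr => V _ /=; rewrite /y.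
      have [sV|nsV] := boolP (stable V); last first.
        rewrite ifN ?mulr0 //.
        by apply: contra nsV; apply: stableS; apply: subsetUr.
      by case: ifPn => // /(SoS_nonstable0 sU sV) ->.
    over.
  by apply=> U /andP[_ /alpha_ge/leq_ltn_trans/(_ alpha_lt)/ltnW].
have mu0 S : ~~ stable S -> mu S = 0.
  move=> nsS; rewrite /mu /moebius big1 ?mulr0 // => U SU.
  by rewrite /y ifN ?mulr0 //; apply: contra nsS; apply: stableS.
have stable0 : stable (set0 : {set G}) by apply/forall_inP => x; rewrite inE.
have sum_mu : \sum_S mu S = 1.
  have := moebiusK y set0; rewrite /y stable0; case: zSoS => -> _ _ <-.
  by apply: eq_bigl => S; rewrite sub0set.
(* [mu] is a probability distribution on stable sets with marginals [z [set i]], so the objective is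
   an expected weight. *)
have -> : \sum_i w i * z [set i] = \sum_S mu S * \sum_(i in S) w i.
  under [RHS]eq_bigr do rewrite mulr_sumr.
  rewrite (exchange_big_dep xpredT) //=; apply: eq_bigr => i _.
  have <- : y [set i] = z [set i].
    rewrite /y ifT //; apply/forall_inP => j /set1P ->.
    by apply/forall_inP => k /set1P ->; rewrite adj_irr.
  rewrite -(moebiusK y) mulr_sumr.
  by apply: eq_big => [S|S _]; rewrite ?sub1set // mulrC.
rewrite -[leRHS]mul1r -sum_mu mulr_suml; apply: ler_sum => S _.
have [sS|/mu0 ->] := boolP (stable S); last by rewrite !mul0r.
by apply: ler_wpM2l => //; apply: le_bigmax_cond.
Qed.

End Exact.
End SoSFacts.

(** * Blow-ups by iterated clique replacement *)

(** Characterised through the projection [p] onto the original vertices, so that the nested sum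
    types of iterated replacements need no explicit isomorphism. *)
Definition blowup (G H : sgraph) (c : G -> nat) (p : H -> G) : Prop :=
  (forall x y, adj x y = (x != y) && ((p x == p y) || adj (p x) (p y))) /\
  (forall v, #|[set x | p x == v]| = c v).

Lemma blowup_replacement (G H : sgraph) (c : G -> nat) (p : H -> G)
    (v : G) (k : nat) :
  blowup c p -> c v = 1%N -> exists u : H, exists q : clique_replacement u k -> G,
    blowup (fun x => if x == v then k else c x) q.
Proof.
move=> [adjE fibE] cv.
have /cards1P[u fibv] : #|[set x | p x == v]| == 1%N by rewrite fibE cv.
have pE x : (p x == v) = (x == u).
  by move/setP/(_ x): fibv; rewrite !inE.
have pu : p u = v by apply/eqP; rewrite pE.
exists u; exists (fun a => match a with inl x => p (val x) | inr _ => v end).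
split=> [[x|i] [y|j] /=|x].
- by rewrite adjE.
- have /negPf xu := valP x.
  by rewrite adjE xu /= pu.
- have /negPf yu := valP y.
  by rewrite adjE eq_sym yu /= pu.
- by rewrite eqxx /= andbT.
transitivity (\sum_(y : {y : H | y != u} | p (val y) == x) 1 +
    \sum_(i < k | v == x) 1)%N.
  by rewrite -sum1_card big_sumType; congr (_ + _)%N; apply: eq_bigl => y; rewrite inE.
have [->|xv] := eqVneq x v.
  rewrite big_pred0 ?add0n; last first.
    by move=> y; rewrite pE (negPf (valP y)).
  by rewrite (eq_bigl xpredT) ?sum1_card ?card_ord // => i; rewrite eqxx.
rewrite [X in (_ + X)%N]big_pred0 // addn0 /=.
rewrite -(fibE x) -sum1_card [RHS](reindex_omap (val : {x : H | x != u} -> H) insub) /=.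
  apply: eq_bigl => y; rewrite inE valK eqxx andbT //.
move=> y; rewrite inE => /eqP py; rewrite insubT // -pE py //.
Qed.

Lemma blowup_exists (C : sgraph -> Prop) (G : sgraph) (c : G -> nat) :
  closed_under_clique_replacement C -> C G -> (forall v, 0 < c v)%N ->
  exists H : sgraph, exists p : H -> G, C H /\ blowup c p.
Proof.
move=> Ccl CG c_gt0.
(* Vertices are replaced one at a time; those not yet in [s] keep a one-point fibre, as
   [blowup_replacement] demands. *)
suff aux (s : seq G) : uniq s -> exists H : sgraph, exists p : H -> G,
    C H /\ blowup (fun v => if v \in s then c v else 1%N) p.
  have [H [p [CH [adjE fibE]]]] := aux _ (enum_uniq G).
  by exists H, p; split=> //; split=> // v; rewrite fibE mem_enum.
elim: s => [_|v s IH /= /andP[vs /IH[H [p [CH Hp]]]]].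
  exists G, id; split=> //; split=> [x y|v] /=.
    by case: eqVneq => //= ->; rewrite adj_irr.
  by rewrite -[RHS](cards1 v); apply: eq_card => x; rewrite !inE.
have [|u [q [adjE fibE]]] := blowup_replacement (v := v) (c v) Hp.
  by rewrite (negPf vs).
exists (clique_replacement u (c v)), q; split; first exact: Ccl.
by split=> // x; rewrite fibE in_cons; case: eqVneq => // ->.
Qed.

Section Blowup.
Variables (G H : sgraph) (c : G -> nat) (p : H -> G).
Hypothesis Hp : blowup c p.

(** A section of [p] embeds stable sets of [G] into [H], so the condition [t <= alpha] passes to the
    blow-up. *)
Lemma blowup_alpha : (forall v, 0 < c v)%N -> (alpha G <= alpha H)%N.
Proof.
case: Hp => adjE fibE c_gt0; apply/bigmax_leqP => A /forall_inP sA.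
have sec v : exists x, p x == v.
  have /card_gt0P[x] : (0 < #|[set x | p x == v]|)%N by rewrite fibE.
  by rewrite inE; exists x.
pose s v := xchoose (sec v).
have sK : cancel s p by move=> v; apply/eqP/(xchooseP (sec v)).
rewrite -(card_imset A (can_inj sK)); apply: alpha_ge.
apply/forall_inP => _ /imsetP[x xA ->]; apply/forall_inP => _ /imsetP[y yA ->].
rewrite adjE !sK negb_and negbK negb_or.
rewrite (can_eq sK); case: eqVneq => //= _.
by have /forall_inP/(_ y yA) := sA x xA.
Qed.

Lemma blowup_omega (m : nat) :
  (forall K : {set G}, clique K -> \sum_(v in K) c v <= m)%N -> (omega H <= m)%N.
Proof.
case: Hp => adjE fibE cm; apply/bigmax_leqP => A /forall_inP cA.
apply: leq_trans (cm (p @: A) _); last first.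
  apply/forall_inP => _ /imsetP[x xA ->]; apply/forall_inP => _ /imsetP[y yA ->].
  apply/implyP => pxy; have xy : x != y by apply: contraNneq pxy => ->.
  have /forall_inP/(_ y yA) := cA x xA; rewrite xy /= adjE xy /=.
  by rewrite (negPf pxy).
rewrite -sum1_card (partition_big_imset p); apply: leq_sum => v _.
rewrite -fibE sum1_card; apply: subset_leq_card; apply/subsetP => x.
by rewrite !inE => /andP[].
Qed.

Lemma blowup_chi (R : realType) (w : G -> R) : (forall v, 0 <= w v) ->
  \sum_v (c v)%:R * w v <= (chi H)%:R * max_stable_weight w.
Proof.
case: Hp => adjE fibE w_ge0.
have /existsP[f /forallP fcol] : colorable H (chi H).
  by rewrite /chi; case: ex_minnP.
have -> : \sum_v (c v)%:R * w v = \sum_x w (p x).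
  rewrite (partition_big p xpredT) //=; apply: eq_bigr => v _.
  rewrite -fibE mulr_natl -sumr_const; apply: eq_big => x; rewrite ?inE //.
  by move/eqP->.
rewrite (partition_big f xpredT) //=.
rewrite -[X in X%:R]card_ord mulr_natl -sumr_const; apply: ler_sum => k _.
pose A := [set x | f x == k].
have sA x y : x \in A -> y \in A -> ~~ adj x y.
  rewrite !inE => /eqP fx /eqP fy; apply/negP => xy.
  by have /forallP/(_ y)/implyP/(_ xy) := fcol x; rewrite fx fy eqxx.
have pinj : {in A &, injective p}.
  (* Fibres of [p] are cliques, so a colour class meets each at most once. *)
  move=> x y xA yA pxy; have := sA x y xA yA; rewrite adjE pxy eqxx andbT.
  by rewrite negbK => /eqP.
have -> : \sum_(x | f x == k) w (p x) = \sum_(v in p @: A) w v.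
  by rewrite big_imset //=; apply: eq_bigl => x; rewrite inE.
apply: le_bigmax_cond; apply/forall_inP => _ /imsetP[x xA ->].
apply/forall_inP => _ /imsetP[y yA ->].
have := sA x y xA yA; rewrite adjE; case: eqVneq => [->|_] /=.
  by rewrite adj_irr.
by rewrite negb_or => /andP[].
Qed.

End Blowup.

(** * Rounding to a blow-up and passing to the limit *)

Theorem theorem2 (R : realType) (C : sgraph -> Prop) (t : nat) (gamma : R)
    (t_ge1 : (1 <= t)%N) (gamma_ge1 : 1 <= gamma)
    (C_closed : closed_under_clique_replacement C)
    (C_bounded : class_cond_chi_bounded t gamma C)
    (G : sgraph) (CG : C G) (w : G -> R) (w_ge0 : forall i, 0 <= w i) :
  (SoS_value t w <= (gamma * max_stable_weight w)%:E)%E.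
Proof.
apply: ge_ereal_sup => _ [z zSoS <-]; rewrite lee_fin.
set a := max_stable_weight w.
have a_ge0 : 0 <= a by apply: bigmax_ge_id.
have [alpha_lt|t_le] := ltnP (alpha G) t.
  apply: le_trans (SoS_exact t_ge1 zSoS alpha_lt w_ge0) _.
  by rewrite ler_peMl.
have z_ge0 i : 0 <= z [set i] by apply: (SoS_ge0 zSoS); rewrite cards1.
have bound (N : nat) :
    N%:R * \sum_i w i * z [set i] <= gamma * (N + #|G|)%:R * a.
  (* The successor keeps every clique nonempty and makes [c i] exceed [N * z [set i]]; it costs at
     most 1 per vertex, hence the error [#|G|]. *)
  pose c i := (Num.trunc (N%:R * z [set i])).+1.
  have [H [p [CH Hp]]] := blowup_exists (c := c) C_closed CG (fun=> isT).
  have omegaH : (omega H <= N + #|G|)%N.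
    apply: (blowup_omega Hp) => K cK.
    rewrite -(ler_nat R) natr_sum natrD.
    apply: (@le_trans _ _ (\sum_(i in K) (N%:R * z [set i] + 1))).
      apply: ler_sum => i _; rewrite /c -natr1 lerD2r.
      by rewrite truncn_le mulr_ge0.
    rewrite big_split /= -mulr_sumr sumr_const; apply: lerD.
      by rewrite ler_piMr ?ler0n // (SoS_clique_sum_le1 t_ge1 zSoS).
    by rewrite ler_nat max_card.
  apply: le_trans (_ : (chi H)%:R * a <= _).
    apply: le_trans (blowup_chi Hp w_ge0).
    rewrite mulr_sumr; apply: ler_sum => i _; rewrite mulrCA mulrC.
    by apply: ler_wpM2r => //; apply/ltW/truncnS_gt.
  apply: ler_wpM2r => //.
  have chiH : (chi H)%:R <= gamma * (omega H)%:R.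
    by apply: C_bounded CH _; apply: leq_trans t_le (blowup_alpha Hp (fun=> isT)).
  apply: le_trans chiH _.
  by rewrite ler_pM2l ?ler_nat // (lt_le_trans ltr01).
(* If the excess [d] were positive, [bound] would give [N * d <= gamma * #|G| * a] for every [N],
   against the Archimedean property. *)
rewrite leNgt; apply/negP; rewrite -subr_gt0.
set s := \sum_i _ in bound *; set d := s - _ => d_gt0.
have k_ge0 : 0 <= gamma * #|G|%:R * a.
  by rewrite !mulr_ge0 // (le_trans ler01).
have := archi_boundP (divr_ge0 k_ge0 (ltW d_gt0)).
set N := Num.bound _; rewrite ltr_pdivrMr // => lt.
have := bound N; rewrite natrD leNgt => /negP[].
by move: lt; rewrite /d; lra.
Qed.
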